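(* Let $f$ be a bijection from the set of ugly ballot sequences to the set of bad ballot sequences that does not change the number of votes for either candidate (i.e. $f(s)$ has the same number of votes for $A$ and the same number of votes for $B$ as $s$, for every ugly $s$). Consider the following step, applicable to an ugly ballot sequence: apply $f$ to change it into a bad sequence, then replace the initial vote for $B$ by a vote for $A$. Then, for every length, iterating this step as long as the ballot sequence is ugly terminates for each starting sequence, and defines a bijection from the set of non-bad ballot sequences of that length in which $A$ has a final margin of $1$ or $2$ votes over $B$ to the set of all good ballot sequences of the same length.
   Context: A ballot sequence is a finite sequence of votes, each for candidate $A$ or for candidate $B$, in which $A$ wins overall, i.e. receives strictly more votes in total than $B$. The final margin of $A$ over $B$ is the number of votes for $A$ minus the number of votes for $B$. A ballot sequence is called: - good if $A$ has a strict lead over $B$ after each vote counted, from the first vote onwards (every nonempty initial segment contains strictly more votes for $A$ than for $B$); - bad if the first vote is for $B$; - ugly if the first vote is for $A$ but $A$ fails to maintain a strict lead throughout (some nonempty initial segment contains at least as many votes for $B$ as for $A$). Thus each ballot sequence is of exactly one of these three types. The length of a ballot sequence is its total number of votes. *)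

(* Defs.v *)
From mathcomp Require Import all_boot all_order all_algebra.
From mathcomp Require Import classical_sets functions.
Set Implicit Arguments.
Unset Strict Implicit.
Unset Printing Implicit Defensive.
Import GRing.Theory.
Local Open Scope classical_set_scope.

Notation vote := bool (only parsing).
Notation voteA := true (only parsing).
Notation voteB := false (only parsing).

Definition votesA (s : seq vote) : nat := count_mem voteA s.
Definition votesB (s : seq vote) : nat := count_mem voteB s.

Definition ballot (s : seq vote) : bool := votesB s < votesA s.

Definition margin (s : seq vote) : int := ((votesA s)%:Z - (votesB s)%:Z)%R.

(* [take k.+1 s] for [k < size s] ranges over the nonempty initial segments. *)
Definition good (s : seq vote) : bool :=
  ballot s &&
  [forall k : 'I_(size s), votesB (take k.+1 s) < votesA (take k.+1 s)].

Definition bad (s : seq vote) : bool :=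
  ballot s && (ohead s == Some voteB).

Definition ugly (s : seq vote) : bool :=
  [&& ballot s, ohead s == Some voteA &
   [exists k : 'I_(size s), votesA (take k.+1 s) <= votesB (take k.+1 s)]].

(* Only meaningful when [s] is ugly, so that [f s] begins with a vote for B. *)
Definition step (f : seq vote -> seq vote) (s : seq vote) : seq vote :=
  set_nth voteB (f s) 0 voteA.

(* The iteration started at [s] applies [step f] as long as the current
   sequence is ugly, and halts with result [t].  Since [k] is the first index
   at which the sequence is not ugly, there is at most one such [t]. *)
Definition halts_at (f : seq vote -> seq vote) (s t : seq vote) : Prop :=
  exists k : nat,
    [/\ forall j : nat, j < k -> ugly (iter j (step f) s),
        ~~ ugly (iter k (step f) s) & t = iter k (step f) s].

Definition start_set (n : nat) : set (seq vote) :=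
  [set s | [/\ size s = n, ballot s, ~~ bad s &
               margin s = 1%R \/ margin s = 2%R]].

Definition good_set (n : nat) : set (seq vote) :=
  [set s | size s = n /\ good s].

(* Main.v *)
Require Import Defs.
From mathcomp Require Import all_boot all_order all_algebra.
From mathcomp Require Import zify.
From mathcomp Require Import classical_sets functions.
Set Implicit Arguments.
Unset Strict Implicit.
Local Open Scope classical_set_scope.

(** On ugly sequences the step turns one vote for B into a vote for A, so it
    keeps the length and raises the margin by 2. Since votes for B run out,
    the iteration terminates ([halts_at_run]).

    The step is moreover a bijection from the ugly sequences onto the non-bad
    ballot sequences of margin at least 3: [f] is a bijection onto the bad
    sequences, and switching the initial vote from B to A is a bijection from
    the bad sequences onto those of margin at least 3 that begin with A
    ([step_inj], [step_surj]). Hence on non-bad ballot sequences the step is a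
    partial injection, defined exactly off the good sequences, whose range
    misses exactly the sequences of margin 1 or 2. Its orbits are thus disjoint
    finite chains, each of which begins with margin 1 or 2 and ends in a good
    sequence. Mapping the beginning of each chain to its end is the bijection:
    it is injective because two runs that meet can be traced back in parallel
    until one of them, hence both, reach a beginning ([run_inj]), and it is
    surjective because tracing a good sequence back lowers the margin until a
    beginning is reached ([run_origin]). *)

Lemma size_votes s : size s = votesA s + votesB s.
Proof. by rewrite -(count_predC (pred1 true)); congr addn; apply: eq_count; case. Qed.

Lemma ugly_ballot s : ugly s -> ballot s.
Proof. by case/and3P. Qed.

Lemma ugly_nonbad s : ugly s -> ~~ bad s.
Proof. by case/and3P=> _ /eqP hs _; rewrite /bad hs andbF. Qed.

Lemma good_ballot s : good s -> ballot s.
Proof. by case/andP. Qed.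

Lemma good_nonugly s : good s -> ~~ ugly s.
Proof.
case/andP=> _ /forallP lead; apply/negP=> /and3P[_ _ /existsP[k]].
by rewrite leqNgt lead.
Qed.

Lemma nonbadP s : ballot s -> ~~ bad s -> exists r, s = true :: r.
Proof. by rewrite /bad; case: s => [|[] r] //= bs; [exists r | rewrite bs]. Qed.

Lemma good_nonbad s : good s -> ~~ bad s.
Proof.
case: s => [|[] r] /andP[bs /forallP /= lead]; rewrite /bad //= ?andbF //.
by have := lead ord0; rewrite /= take0.
Qed.

Lemma nonugly_good s : ballot s -> ~~ bad s -> ~~ ugly s -> good s.
Proof.
move=> bs nbs; rewrite /good /ugly bs; have [r ->] := nonbadP bs nbs.
by rewrite /= negb_exists; under eq_forallb do rewrite -ltnNge.
Qed.

Lemma margin12P s : ballot s ->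
  (margin s = 1%R \/ margin s = 2%R) <-> votesA s <= votesB s + 2.
Proof. by rewrite /ballot /margin; lia. Qed.

Lemma stepE f s : bad (f s) ->
  exists2 r, f s = false :: r & step f s = true :: r.
Proof. by rewrite /bad /step; case: (f s) => [|[] r] /andP[_] //; exists r. Qed.

Lemma step_votes f s : bad (f s) ->
  votesA (f s) = votesA s -> votesB (f s) = votesB s ->
  votesA (step f s) = (votesA s).+1 /\ votesB s = (votesB (step f s)).+1.
Proof. by case/stepE=> r -> -> <- <-. Qed.

Lemma step_nonbad f s : bad (f s) -> ~~ bad (step f s).
Proof. by case/stepE=> r _ ->; rewrite /bad andbF. Qed.

Lemma step_inj f : set_bij [set s | ugly s] [set s | bad s] f ->
  {in ugly &, injective (step f)}.
Proof.
case=> f_bad f_inj _ s s' us us'.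
have [r fs ->] := stepE (f_bad _ us); have [r' fs' ->] := stepE (f_bad _ us').
by case=> eq_r; apply: f_inj; rewrite ?inE // fs fs' eq_r.
Qed.

(** A margin of at least 3 is what leaves a ballot sequence, in fact a bad
    one, once the initial vote for A is switched back to B. *)
Lemma step_surj f t : set_bij [set s | ugly s] [set s | bad s] f ->
  ballot t -> ~~ bad t -> votesB t + 2 < votesA t ->
  exists2 s, ugly s & step f s = t.
Proof.
case=> _ _ f_surj bt nbt; have [r ->] := nonbadP bt nbt => lead.
have br : bad (false :: r).
  by move: lead; rewrite /bad /ballot /votesA /votesB /= andbT; lia.
by have [s us fs] := f_surj _ br; exists s; rewrite // /step fs.
Qed.

(** A sequence that is not ugly is a fixed point of the guarded step, so any
    number of rounds that suffices for halting gives the same result; each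
    actual step uses up one vote for B, whence [votesB s] rounds suffice. *)
Definition run f s := iter (votesB s) (fun t => if ugly t then step f t else t) s.

Section Runs.

Context (f : seq bool -> seq bool).
Context (f_bij : set_bij [set s | ugly s] [set s | bad s] f).
Context (f_votes : forall s : seq bool, ugly s ->
  votesA (f s) = votesA s /\ votesB (f s) = votesB s).

Let f_bad s : ugly s -> bad (f s).
Proof. by case: f_bij => f_bad _ _; apply: f_bad. Qed.

Lemma ugly_step_votes s : ugly s ->
  votesA (step f s) = (votesA s).+1 /\ votesB s = (votesB (step f s)).+1.
Proof. by move=> us; have [? ?] := f_votes us; apply: step_votes => //; apply: f_bad. Qed.

Lemma ugly_step_ballot s : ugly s -> ballot (step f s).
Proof.
move=> us; have := ugly_ballot us; rewrite /ballot.
by have [] := ugly_step_votes us; lia.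
Qed.

Lemma ugly_step_size s : ugly s -> size (step f s) = size s.
Proof. by move=> us; have [] := ugly_step_votes us; rewrite !size_votes; lia. Qed.

Lemma halts_at_run s : halts_at f s (run f s).
Proof.
rewrite /run; move Em: (votesB s) => m.
elim: m s Em => [|m IHm] s Em.
  exists 0; split=> //; apply/negP=> us.
  by have [_] := ugly_step_votes us; rewrite Em.
rewrite iterSr; case: ifPn => [us | nus]; last first.
  by exists 0; split=> //; apply: iter_fix; rewrite (negPf nus).
have [_] := ugly_step_votes us; rewrite Em => -[/esym Em'].
have [k [hk nuk ->]] := IHm _ Em'.
exists k.+1; split; rewrite ?iterSr //.
by case=> [|j] // ltjk; rewrite iterSr; apply: hk.
Qed.

Lemma iter_step_invariant k s :
  (forall j, j < k -> ugly (iter j (step f) s)) -> ballot s -> ~~ bad s ->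
  [/\ size (iter k (step f) s) = size s, ballot (iter k (step f) s)
    & ~~ bad (iter k (step f) s)].
Proof.
elim: k => [|k IHk] //= hk bs nbs; have uk := hk k (ltnSn k).
have [|sz _ _] := IHk _ bs nbs; first by move=> j ltjk; apply/hk/ltnW.
split; first by rewrite ugly_step_size.
  exact: ugly_step_ballot.
by apply/step_nonbad/f_bad.
Qed.

Lemma run_good n s : start_set n s -> good_set n (run f s).
Proof.
case=> szs bs nbs _; have [k [hk nuk ->]] := halts_at_run s.
have [sz bk nbk] := iter_step_invariant hk bs nbs.
by split; [rewrite sz | apply: nonugly_good].
Qed.

(** The result of a step has margin at least 3, so no run passes through a
    starting sequence after its first index. *)
Lemma start_not_step n s u : start_set n s -> ugly u -> step f u <> s.
Proof.
case=> _ bs _ /(margin12P bs) lead uu eq_s; move: lead; rewrite -eq_s.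
by have := ugly_ballot uu; rewrite /ballot; have [] := ugly_step_votes uu; lia.
Qed.

Lemma run_inj n : set_inj (start_set n) (run f).
Proof.
move=> s s'; rewrite !inE => ss ss'.
have [k [hk _ ->]] := halts_at_run s; have [k' [hk' _ ->]] := halts_at_run s'.
elim: k k' hk hk' => [|k IHk] [|k'] //= hk hk'.
- by move/esym/(start_not_step ss (hk' k' (ltnSn k'))).
- by move/(start_not_step ss' (hk k (ltnSn k))).
move/(step_inj f_bij (hk k (ltnSn k)) (hk' k' (ltnSn k'))).
by apply: (IHk k') => j ltj; [apply/hk/ltnW | apply/hk'/ltnW].
Qed.

(** The induction tracing [t] back goes through ugly sequences, which is why
    the claim covers all non-bad [t] and not only good ones. *)
Lemma run_origin n t : size t = n -> ballot t -> ~~ bad t ->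
  exists s k, [/\ start_set n s,
    forall j, j < k -> ugly (iter j (step f) s) & iter k (step f) s = t].
Proof.
move Em: (votesA t) => m; elim: m t Em => [|m IHm] t Em szt bt nbt.
  by move: bt; rewrite /ballot Em.
have [lead | lead] := leqP (votesA t) (votesB t + 2).
  by exists t, 0; split=> //; split=> //; apply/margin12P.
have [u uu stu] := step_surj f_bij bt nbt lead.
have [eqA _] := ugly_step_votes uu; rewrite stu Em in eqA; case: eqA => eqA.
have [||||s [k [ss hk eq_u]]] := IHm u; rewrite -?eqA ?ugly_ballot ?ugly_nonbad //.
  by rewrite -(ugly_step_size uu) stu.
exists s, k.+1; split; rewrite ?iterS ?eq_u // => j.
by rewrite ltnS leq_eqVlt => /predU1P[-> | /hk //]; rewrite eq_u.
Qed.

Lemma halts_at_uniq s t t' : halts_at f s t -> halts_at f s t' -> t = t'.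
Proof.
move=> [k [hk nk ->]] [k' [hk' nk' ->]].
by case: (ltngtP k k') => [/hk' | /hk | -> //]; rewrite ?(negPf nk) ?(negPf nk').
Qed.

Lemma run_surj n : set_surj (start_set n) (good_set n) (run f).
Proof.
move=> t [szt gt]; have [bt nbt] := (good_ballot gt, good_nonbad gt).
have [s [k [ss hk eq_t]]] := run_origin szt bt nbt.
exists s => //; apply: halts_at_uniq (halts_at_run s) _.
by exists k; rewrite eq_t good_nonugly.
Qed.

End Runs.

Theorem proposition3 (f : seq bool -> seq bool)
    (f_bij : set_bij [set s | ugly s] [set s | bad s] f)
    (f_votes : forall s : seq bool, ugly s ->
       votesA (f s) = votesA s /\ votesB (f s) = votesB s)
    (n : nat) :
  (forall s : seq bool, size s = n -> ballot s ->
     exists t : seq bool, halts_at f s t) /\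
  (exists g : seq bool -> seq bool,
     (forall s : seq bool, start_set n s -> halts_at f s (g s)) /\
     set_bij (start_set n) (good_set n) g).
Proof.
have halts := halts_at_run f_bij f_votes.
split=> [s _ _ |]; first by exists (run f s).
exists (run f); split=> [s _ | ]; first exact: halts.
split; [exact: run_good | exact: run_inj | exact: run_surj].
Qed.
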